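(* Let $n\ge 2$, let $N$ be an orientable $n$-manifold, and let $L_1,L_2\subset J^1(N)$ be closed orientable $n$-dimensional Legendrian submanifolds with a cusp connected sum $L=L_1\# L_2$, set up as described in the context. Assume $L_1,L_2,L$ are spin with vanishing Maslov class. Let $(A_{\mathbb C H_1(L_1)},\partial_{L_1})$, $(A_{\mathbb C H_1(L_2)},\partial_{L_2})$, $(A_{\mathbb C H_1(L)},\partial_L)$ be the Legendrian contact algebras of $L_1,L_2,L$ with coefficients in $\mathbb C[H_1(L_1)]$, $\mathbb C[H_1(L_2)]$, $\mathbb C[H_1(L)]$ respectively. Then, under the identification $\mathrm{Spec}(\mathbb C[H_1(L)])\cong \mathrm{Spec}(\mathbb C[H_1(L_1)])\times\mathrm{Spec}(\mathbb C[H_1(L_2)])$ induced by $\mathbb C[H_1(L)]\cong\mathbb C[H_1(L_1)]\otimes_{\mathbb C}\mathbb C[H_1(L_2)]$, one has, as algebraic subsets, $$\mathrm{Aug}(A_{\mathbb C H_1(L_1)},\partial_{L_1})\times\mathrm{Aug}(A_{\mathbb C H_1(L_2)},\partial_{L_2})=\mathrm{Aug}(A_{\mathbb C H_1(L)},\partial_L).$$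
   Context: **Jet space and contact algebra.** $J^1(N)=T^*N\times\mathbb R$ has contact form $dz-\sum_i y_i\,dx_i$; Reeb chords of a Legendrian $\Lambda$ are vertical segments with both endpoints on $\Lambda$; $\pi_F:J^1(N)\to N\times\mathbb R$ is the front projection and $\pi_{\mathbb C}:J^1(N)\to T^*N$ the Lagrangian projection. For a spin Legendrian $\Lambda$ and coefficient ring $R=\mathbb C$ or $\mathbb C[H_1(\Lambda)]$, the Legendrian contact algebra of $\Lambda$ is the unital tensor algebra over $R$ freely generated by the Reeb chords. A chord $c$ at a critical point $x$ of the difference $f_i-f_j>0$ of two local sheet functions of the front, with endpoints in one component, has grading $|c|=D(\gamma_c)-U(\gamma_c)+\mathrm{ind}_x(f_i-f_j)-1$, with $\gamma_c$ a capping path in $\Lambda$ from the upper to the lower endpoint of $c$ and $D,U$ the numbers of cusp edges it traverses downwards and upwards (a modified choice is used for chords between different components). The differential $\partial a$ is the signed count $\sum\pm A\,b_1\cdots b_m$ of rigid $J$-holomorphic disks in $T^*N$ with boundary on $\pi_{\mathbb C}(\Lambda)$, one positive puncture at $a$, negative punctures at $b_1,\dots,b_m$, and boundary (closed up with capping paths) in class $A\in H_1(\Lambda)$ (with $A$ replaced by $1$ when $R=\mathbb C$), extended by the graded Leibniz rule. **Augmentations.** For a unital DGA $(A,\partial)$ freely generated over $R$, an augmentation is a unital (graded) DGA morphism $\epsilon:(A,\partial)\to(R,0)$, with $R$ in degree $0$; with the automorphism $\sigma_\epsilon(c)=c+\epsilon(c)$ on generators, the differential $\partial^\epsilon=\sigma_\epsilon\partial\sigma_\epsilon^{-1}$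 then has no nonzero constant (word-length $0$) term. $(A,\partial)$ is good if it has an augmentation. **Augmentation variety.** For a finitely generated commutative $\mathbb C$-algebra $S$, $\mathrm{Spec}(S)$ denotes the set of maximal ideals with the Zariski topology (closed sets $Z(I)=\{m: I\subset m\}$). Let $\Lambda$ be spin with vanishing Maslov class and $(A,\partial)$ its contact algebra over $\mathbb C[H_1(\Lambda)]$. A $\mathbb C$-algebra morphism $p:\mathbb C[H_1(\Lambda)]\to\mathbb C$ induces by change of coefficients a DGA $(pA,p\partial)$ over $\mathbb C$; $p$ (equivalently its kernel, a point of $\mathrm{Spec}(\mathbb C[H_1(\Lambda)])$) is good if $(pA,p\partial)$ is good. $\mathrm{Aug}(A,\partial)$ is the Zariski closure in $\mathrm{Spec}(\mathbb C[H_1(\Lambda)])$ of the set of good points. **Cusp connected sum.** After a Legendrian isotopy (assumed to exist), the fronts of $L_1,L_2$ are separated by a hyperplane (hypersurface) in $N\times\mathbb R$ containing the $z$-direction. Choose an arc from a cusp edge of $L_1$ to a cusp edge of $L_2$, parameterized by $s\in[-1,1]$, and a neighborhood $M$ of it whose vertical cross-sections are round balls whose radii have exactly one minimum, at $s=0$, and no other critical points. Cusp off $M$ appropriately and let $L=L_1\#L_2$ be the union of $L_1\setminus(L_1\cap M)$, $L_2\setminus(L_2\cap M)$ and $\partial M$. Since $n\ge2$, $H_1(L)\cong H_1(L_1)\oplus H_1(L_2)$, so $\mathbb C[H_1(L)]\cong\mathbb C[H_1(L_1)]\otimes_{\mathbb C}\mathbb C[H_1(L_2)]$; let $\rho_i:\mathbb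 C[H_1(L_i)]\to\mathbb C[H_1(L)]$ be the natural maps. By a known result (Ekholm–Etnyre–Sullivan), the connected sum can be set up, and here is assumed set up, so that: the Reeb chords of $L$ are those of $L_1$, those of $L_2$, and one additional chord $h$ (with $\rho_i$ extended to the contact algebras by the identity on chords); for each chord $c$ of $L_i$, its grading is the same in $L_i$ and in $L$, and both $\partial c-\partial_i c$ (coefficients $\mathbb C$) and $\partial_L c-\rho_i\partial_{L_i}c$ (extended coefficients) are divisible by $h$, i.e. every word occurring in them contains $h$; and $|h|=n-1$, with $h$ closed for each of the differentials. Here $\partial$, $\partial_i$ denote the differentials of $L$, $L_i$ with $\mathbb C$ coefficients. *)

(* Defs.v *)
From HB Require Import structures.
From mathcomp Require Import all_boot all_order all_algebra.
From mathcomp Require Import ring zify finmap monalg complex.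
From mathcomp Require Import boolp classical_sets functions reals topology.

Set Implicit Arguments.
Unset Strict Implicit.
Unset Printing Implicit Defensive.

Import GRing.Theory.

Local Open Scope ring_scope.

Section LinearExtension.
Context (K : choiceType) (R : comNzRingType) (V : lmodType R).

Definition lext (h : K -> V) (g : {malg R[K]}) : V :=
  \sum_(k <- msupp g) g@_k *: h k.

Variable h : K -> V.

Lemma lextEw (d : {fset K}) (g : {malg R[K]}) :
  fsubset (msupp g) d -> lext h g = \sum_(k <- d) g@_k *: h k.
Proof.
move=> le; rewrite /lext (big_fset_incl _ le) => //= x xd /mcoeff_outdom ->.
by rewrite scale0r.
Qed.

Lemma lext_is_additive : {morph lext h : x y / x - y}.
Proof.
move=> x y; pose d := fsetU (msupp x) (msupp y).
rewrite (@lextEw d x) ?fsubsetUl // (@lextEw d y) ?fsubsetUr //.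
rewrite (@lextEw d) ?msuppB_le // -sumrB.
by apply: eq_bigr => k _; rewrite mcoeffB scalerBl.
Qed.

Lemma lext_is_scalable : scalable (lext h).
Proof.
move=> c x; rewrite (lextEw (msuppZ_le c x)) scaler_sumr.
by apply: eq_bigr => k _; rewrite mcoeffZ scalerA.
Qed.

HB.instance Definition _ :=
  GRing.isAdditive.Build {malg R[K]} V (lext h) lext_is_additive.
HB.instance Definition _ :=
  GRing.isScalable.Build R {malg R[K]} V *:%R (lext h) lext_is_scalable.

Lemma lextU c k : lext h << c *g k >> = c *: h k.
Proof. by rewrite (lextEw msuppU_le) big_seq_fset1 mcoeffUU. Qed.

End LinearExtension.

Lemma malg_ind (K : choiceType) (G : zmodType) (P : {malg G[K]} -> Prop) :
  P 0 -> (forall x y, P x -> P y -> P (x + y)) ->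
  (forall c k, P << c *g k >>) -> forall x, P x.
Proof.
move=> P0 PD PU x; rewrite [x]monalgE.
by apply: (big_ind P) => // k _; exact: PU.
Qed.

(* [monalg] only multiplies over monoids without nontrivial units, so the
   convolution product on the free module over an additively written abelian
   group H is defined here; << c *g a >> is the monomial c e^a. *)
Definition galg (k : comNzRingType) (H : zmodType) : Type := {malg k[H]}.

Section GroupAlgebra.
Context (k : comNzRingType) (H : zmodType).

HB.instance Definition _ := GRing.Lmodule.on (galg k H).

Implicit Types x y z : galg k H.

Definition gmul x y : galg k H :=
  lext (fun a => lext (fun b => (<< a + b >> : {malg k[H]})) y) x.

Definition gone : galg k H := << 0%R : H >>.

Lemma gmulDl : left_distributive gmul +%R.
Proof. by move=> x y z; rewrite /gmul raddfD. Qed.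

Lemma gmulDr : right_distributive gmul +%R.
Proof.
move=> x y z; rewrite /gmul /lext -big_split /=; apply: eq_bigr => a _.
by rewrite -scalerDr -/(lext _ y) -/(lext _ z) -raddfD.
Qed.

Lemma gmulUU c d (a b : H) :
  gmul << c *g a >> << d *g b >> = << c * d *g a + b >>.
Proof.
rewrite /gmul !lextU scalerA; apply/malgP => e.
by rewrite mcoeffZ !mcoeffU mulrnAr mulr1.
Qed.

Lemma gmul0l y : gmul 0 y = 0. Proof. by rewrite /gmul raddf0. Qed.

Lemma gmul0r x : gmul x 0 = 0.
Proof. by rewrite /gmul /lext big1 // => a _; rewrite msupp0 big_nil scaler0. Qed.

Lemma gmul_suml I (s : seq I) (F : I -> galg k H) y :
  gmul (\sum_(i <- s) F i) y = \sum_(i <- s) gmul (F i) y.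
Proof. exact: (big_morph (gmul^~ y) (fun _ _ => gmulDl _ _ _) (gmul0l y)). Qed.

Lemma gmul_sumr I (s : seq I) (F : I -> galg k H) x :
  gmul x (\sum_(i <- s) F i) = \sum_(i <- s) gmul x (F i).
Proof. exact: (big_morph (gmul x) (fun _ _ => gmulDr _ _ _) (gmul0r x)). Qed.

Lemma gmulC : commutative gmul.
Proof.
move=> x y; elim/malg_ind: x => [|x x' Hx Hx'|c a].
- by rewrite gmul0l gmul0r.
- by rewrite gmulDl gmulDr Hx Hx'.
elim/malg_ind: y => [|y y' Hy Hy'|d b].
- by rewrite gmul0l gmul0r.
- by rewrite gmulDl gmulDr Hy Hy'.
by rewrite !gmulUU mulrC addrC.
Qed.

Lemma gmulA : associative gmul.
Proof.
move=> x y z; elim/malg_ind: x => [|x x' Hx Hx'|c a].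
- by rewrite !gmul0l.
- by rewrite !gmulDl Hx Hx'.
elim/malg_ind: y => [|y y' Hy Hy'|d b].
- by rewrite gmul0r !gmul0l gmul0r.
- by rewrite gmulDr !gmulDl gmulDr Hy Hy'.
elim/malg_ind: z => [|z z' Hz Hz'|e f].
- by rewrite !gmul0r.
- by rewrite !gmulDr Hz Hz'.
by rewrite !gmulUU mulrA addrA.
Qed.

Lemma gmul1l : left_id gone gmul.
Proof.
move=> x; elim/malg_ind: x => [|x y Hx Hy|c a].
- by rewrite gmul0r.
- by rewrite gmulDr Hx Hy.
by rewrite gmulUU mul1r add0r.
Qed.

Lemma gone_neq0 : gone != 0.
Proof. by apply/eqP => /malgP /(_ 0) /eqP; rewrite mcoeffUU mcoeff0 oner_eq0. Qed.

HB.instance Definition _ := GRing.Zmodule_isComNzRing.Build (galg k H)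
  gmulA gmulC gmul1l gmulDl gone_neq0.

Lemma gscaleAl c x y : c *: (x * y) = (c *: x) * y.
Proof. by rewrite -[RHS]/(gmul _ _) /gmul linearZ. Qed.

HB.instance Definition _ := GRing.Lmodule_isLalgebra.Build k (galg k H) gscaleAl.
HB.instance Definition _ := GRing.Lalgebra_isComAlgebra.Build k (galg k H).

Lemma galgMUU c d (a b : H) :
  (<< c *g a >> : galg k H) * (<< d *g b >> : galg k H) = << c * d *g a + b >>.
Proof. exact: gmulUU. Qed.

Section Lift.
Context (S : comAlgType k) (chi : H -> S).
Hypotheses (chi0 : chi 0 = 1) (chiD : {morph chi : a b / a + b >-> a * b}).

Lemma lext_is_monoid_morphism : monoid_morphism (lext chi : galg k H -> S).
Proof.
split=> [|x y]; first by rewrite -[1]/gone /gone lextU scale1r.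
elim/malg_ind: x => [|x x' Hx Hx'|c a].
- by rewrite mul0r raddf0 mul0r.
- by rewrite mulrDl !raddfD /= mulrDl Hx Hx'.
elim/malg_ind: y => [|y y' Hy Hy'|d b].
- by rewrite mulr0 raddf0 mulr0.
- by rewrite mulrDr !raddfD /= mulrDr Hy Hy'.
by rewrite galgMUU !lextU chiD -scalerAl -scalerAr scalerA.
Qed.
End Lift.

End GroupAlgebra.

(* The morphism k[H] -> k replacing every homology class by 1. *)
Definition gaug (k : comNzRingType) (H : zmodType) : galg k H -> k :=
  lext (fun=> 1 : k^o).

Definition gmap (k : comNzRingType) (H H' : zmodType) (f : H -> H') :
    galg k H -> galg k H' :=
  lext (fun a => << f a >> : galg k H').

Section GroupAlgebraMorphisms.
Context (k : comNzRingType) (H H' : zmodType) (f : {additive H -> H'}).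

HB.instance Definition _ := GRing.Linear.copy (@gaug k H)
  (lext (fun=> 1 : k^o) : galg k H -> k^o).

Lemma gaug_is_monoid_morphism : monoid_morphism (@gaug k H).
Proof.
apply: (@lext_is_monoid_morphism k H k^o (fun=> 1)) => // a b.
by rewrite mulr1.
Qed.

HB.instance Definition _ :=
  GRing.isMonoidMorphism.Build (galg k H) k (@gaug k H) gaug_is_monoid_morphism.

HB.instance Definition _ := GRing.Linear.copy (@gmap k H H' f)
  (lext (fun a => << f a >> : galg k H') : galg k H -> galg k H').

Lemma gmap_is_monoid_morphism : monoid_morphism (@gmap k H H' f).
Proof.
apply: (@lext_is_monoid_morphism k H (galg k H') (fun a => << f a >>)).
  by rewrite raddf0.
by move=> a b; rewrite galgMUU mulr1 raddfD.
Qed.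

HB.instance Definition _ := GRing.isMonoidMorphism.Build
  (galg k H) (galg k H') (@gmap k H H' f) gmap_is_monoid_morphism.

End GroupAlgebraMorphisms.

Lemma signr_absD (R : pzRingType) (a b : int) :
  (-1) ^+ absz (a + b) = (-1) ^+ (absz a + absz b) :> R.
Proof. by rewrite -[LHS]signr_odd -[RHS]signr_odd; congr (_ ^+ nat_of_bool _); lia. Qed.

Lemma malgZAr (K : monomType) (R : comNzRingType) (c : R) (x y : {malg R[K]}) :
  x * (c *: y) = c *: (x * y).
Proof.
have central : x * c%:MP = c%:MP * x.
  rewrite [x]monalgE mulr_suml mulr_sumr; apply: eq_bigr => k _.
  rewrite !(malgMEw msuppU_le msuppU_le) !big_seq_fset1 !mcoeffUU.
  by rewrite mulm1 mul1m mulrC.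
by rewrite -[c *: y]mul_malgC mulrA central -mulrA mul_malgC.
Qed.

(* {malg R[{fmonom X}]} is the unital tensor algebra over R on the set X: its
   basis consists of the words in X, multiplied by concatenation. *)

Section Words.
Context (R : comNzRingType) (X : finType).
Variables (deg : X -> int) (d : X -> {malg R[{fmonom X}]}).

Definition wdeg (w : seq X) : int := \sum_(c <- w) deg c.

Fixpoint dword (w : seq X) : {malg R[{fmonom X}]} :=
  if w is c :: w' then
    d c * << FMonom w' >> + (-1) ^+ absz (deg c) *: (<< FMonom [:: c] >> * dword w')
  else 0.

(* The extension of d to the tensor algebra by R-linearity and the graded
   Leibniz rule, see [dextM]. *)
Definition dext : {malg R[{fmonom X}]} -> {malg R[{fmonom X}]} :=
  lext (fun w : {fmonom X} => dword w).

HB.instance Definition _ := GRing.Linear.copy dext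
  (lext (fun w : {fmonom X} => dword w)).

Lemma fmMU (u v : seq X) (a b : R) :
  << a *g FMonom u >> * << b *g FMonom v >> = << a * b *g FMonom (u ++ v) >>.
Proof.
rewrite (malgMEw msuppU_le msuppU_le) !big_seq_fset1 !mcoeffUU.
by congr mkmalgU; apply/eqP; rewrite fmP fmM.
Qed.

Lemma fmU1 : << FMonom [::] >> = 1 :> {malg R[{fmonom X}]}.
Proof. by congr mkmalgU; apply/eqP; rewrite fmP fm1. Qed.

Lemma dextU c (w : seq X) : dext << c *g FMonom w >> = c *: dword w.
Proof. exact: lextU. Qed.

Lemma dext_gen c : dext << FMonom [:: c] >> = d c.
Proof. by rewrite dextU scale1r /= fmU1 mulr1 mulr0 scaler0 addr0. Qed.

Lemma dextM (u v : seq X) :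
  dext (<< FMonom u >> * << FMonom v >>) =
  dext << FMonom u >> * << FMonom v >>
  + (-1) ^+ absz (wdeg u) *: (<< FMonom u >> * dext << FMonom v >>).
Proof.
rewrite fmMU mulr1 !dextU !scale1r; elim: u => [|c u IHu] /=.
  by rewrite mul0r add0r /wdeg big_nil expr0 scale1r fmU1 mul1r.
have fmcons w : << FMonom (c :: w) >> = << FMonom [:: c] >> * << FMonom w >>
    :> {malg R[{fmonom X}]} by rewrite fmMU mulr1.
have sgnE : (-1) ^+ absz (wdeg (c :: u)) = (-1) ^+ absz (deg c) * (-1) ^+ absz (wdeg u) :> R.
  by rewrite /wdeg big_cons -exprD; apply: signr_absD.
rewrite IHu sgnE (fmcons u).
have -> : << FMonom (u ++ v) >> = << FMonom u >> * << FMonom v >>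
    :> {malg R[{fmonom X}]} by rewrite fmMU mulr1.
move: (d c) (dword u) (dword v) => x y z.
move: << FMonom [:: c] >> << FMonom u >> << FMonom v >> => p q r.
move: ((-1) ^+ absz (deg c)) ((-1) ^+ absz (wdeg u)) => e f.
rewrite [p * (_ + _)]mulrDr [(_ + _) * r]mulrDl [e *: (_ + _)]scalerDr.
rewrite [p * (f *: _)]malgZAr [(e *: _) * r](esym (scalerAl _ _ _)).
rewrite [e *: (f *: _)]scalerA !mulrA; exact: addrA.
Qed.

End Words.

(* Change of coefficients along phi combined with renaming of generators. *)
Definition mapalg (R S : comNzRingType) (X Y : finType) (phi : R -> S)
    (f : X -> Y) : {malg R[{fmonom X}]} -> {malg S[{fmonom Y}]} :=
  fun x => \sum_(w <- msupp x) << phi x@_w *g FMonom (map f w) >>.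

Section ChangeOfCoefficients.
Context (R S : comNzRingType) (X : finType) (phi : {rmorphism R -> S}).

Notation M := (@mapalg R S X X phi id).

Lemma mapalg_idE x w : (M x)@_w = phi x@_w.
Proof.
rewrite /mapalg raddf_sum /= [in RHS](monalgE x) raddf_sum rmorph_sum /=.
apply: eq_bigr => v _; rewrite map_id !mcoeffU rmorphMn.
by congr (_ *+ nat_of_bool (_ == _)); exact: fmK.
Qed.

Lemma mapalg_id_additive : {morph M : x y / x - y}.
Proof. by move=> x y; apply/malgP => w; rewrite !(mapalg_idE, mcoeffB) rmorphB. Qed.

HB.instance Definition _ := GRing.isAdditive.Build _ _ M mapalg_id_additive.

Lemma mapalg_idU c w : M << c *g w >> = << phi c *g w >>.
Proof. by apply/malgP => v; rewrite mapalg_idE !mcoeffU rmorphMn. Qed.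

Lemma mapalg_idZ c x : M (c *: x) = phi c *: M x.
Proof. by apply/malgP => v; rewrite mapalg_idE !mcoeffZ mapalg_idE rmorphM. Qed.

Lemma mapalg_idM x y : M (x * y) = M x * M y.
Proof.
rewrite [x]monalgE [y]monalgE mulr_suml !raddf_sum mulr_suml /=.
apply: eq_bigr => u _; rewrite mulr_sumr !raddf_sum mulr_sumr /=.
apply: eq_bigr => v _; rewrite !mapalg_idU.
by case: u v => u [v]; rewrite !fmMU mapalg_idU rmorphM.
Qed.

Lemma mapalg_id_dext (deg : X -> int) (d : X -> {malg R[{fmonom X}]}) x :
  M (dext deg d x) = dext deg (M \o d) (M x).
Proof.
have Mword w : M (dword deg d w) = dword deg (M \o d) w.
  elim: w => [|c w IHw] /=; first exact: raddf0.
  rewrite raddfD /= mapalg_idZ !mapalg_idM !mapalg_idU IHw.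
  by rewrite rmorphXn rmorphN !rmorph1.
elim/malg_ind: x => [|x y Hx Hy|c [w]].
- by rewrite !raddf0.
- by rewrite !raddfD /= Hx Hy.
by rewrite mapalg_idU !dextU mapalg_idZ Mword.
Qed.

End ChangeOfCoefficients.

(* A unital DGA over R freely generated by the finite set [gen]; R lies in
   degree 0 and the differential has degree -1. *)
Record dga (R : comNzRingType) := Dga {
  gen : finType;
  deg : gen -> int;
  dgen : gen -> {malg R[{fmonom gen}]};
  dgen_deg : forall (c : gen) (w : {fmonom gen}),
    w \in msupp (dgen c) -> wdeg deg w = deg c - 1;
  dgenK : forall x, dext deg dgen (dext deg dgen x) = 0
}.

Definition diff (R : comNzRingType) (D : dga R) :
    {malg R[{fmonom (gen D)}]} -> {malg R[{fmonom (gen D)}]} :=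
  dext (@deg R D) (@dgen R D).

Section Chcoef.
Context (R S : comNzRingType) (phi : {rmorphism R -> S}) (D : dga R).

Let dgen' (c : gen D) := mapalg phi id (dgen c).

Lemma chcoef_deg c (w : {fmonom (gen D)}) :
  w \in msupp (dgen' c) -> wdeg (@deg R D) w = deg c - 1.
Proof.
rewrite -mcoeff_neq0 mapalg_idE => phi_neq0; apply: dgen_deg.
by rewrite -mcoeff_neq0; apply: contra_neq phi_neq0 => ->; rewrite rmorph0.
Qed.

Lemma chcoefK x :
  dext (@deg R D) dgen' (dext (@deg R D) dgen' x) = 0.
Proof.
elim/malg_ind: x => [|x y Hx Hy|c [w]].
- by rewrite !raddf0.
- by rewrite !raddfD /= Hx Hy addr0.
rewrite dextU linearZ -[dword _ _ w]scale1r -dextU /=.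
have -> : << FMonom w >> = mapalg phi id << FMonom w >>.
  by rewrite mapalg_idU rmorph1.
by rewrite -!mapalg_id_dext dgenK raddf0 scaler0.
Qed.

Definition chcoef : dga S := Dga chcoef_deg chcoefK.
End Chcoef.

(* A unital graded DGA morphism to (R, 0), with R in degree 0. *)
Definition augmentation (R : comNzRingType) (D : dga R)
    (eps : {lrmorphism {malg R[{fmonom (gen D)}]} -> R | *%R}) : Prop :=
  (forall w : {fmonom (gen D)}, wdeg (@deg R D) w != 0 -> eps << w >> = 0) /\
  (forall x, eps (diff x) = 0).

Definition good_dga (R : comNzRingType) (D : dga R) : Prop :=
  exists eps : {lrmorphism {malg R[{fmonom (gen D)}]} -> R | *%R},
    augmentation eps.

Local Open Scope classical_set_scope.

(* [idealr_closed] includes properness. *)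
Definition maximal_ideal (S : comNzRingType) (m : set S) : Prop :=
  idealr_closed (mem m) /\
  forall J : set S, idealr_closed (mem J) -> m `<=` J -> J = m.

Record mspec (S : comNzRingType) := MSpec {
  mideal :> set S;
  mideal_max : maximal_ideal mideal
}.

Lemma mspec_inj (S : comNzRingType) (m m' : mspec S) :
  mideal m = mideal m' -> m = m'.
Proof.
by case: m m' => [m p] [m' p'] /= mm'; case: _ / mm' p' => p'; congr MSpec.
Qed.

(* E need not be an ideal: zeros E = zeros I for I the ideal generated by E. *)
Definition zeros (S : comNzRingType) (E : set S) : set (mspec S) :=
  [set m | E `<=` mideal m].

Section Zariski.
Context (S : comNzRingType).

HB.instance Definition _ := gen_eqMixin (mspec S).
HB.instance Definition _ := gen_choiceMixin (mspec S).

Lemma mspec_ideal (m : mspec S) :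
  [/\ mideal m 0, ~ mideal m 1 &
      forall a u v, mideal m u -> mideal m v -> mideal m (a * u + v)].
Proof.
have [[m0 m1 mD] _] := mideal_max m; split.
- by rewrite -[mideal m 0]inE.
- by move=> /mem_set m1'; move: m1; rewrite m1'.
by move=> a u v /mem_set mu /mem_set mv; apply/set_mem/mD.
Qed.

Lemma mspec_prime (m : mspec S) (e f : S) :
  mideal m (e * f) -> mideal m e \/ mideal m f.
Proof.
have [m0 m1 mD] := mspec_ideal m; move=> mef.
have [me|Nme] := pselect (mideal m e); [by left|right].
pose J := [set x | exists a, mideal m (x - a * e)].
have mJ : mideal m `<=` J by move=> x mx; exists 0; rewrite mul0r subr0.
have Je : J e by exists 1; rewrite mul1r subrr.
have [[a m1a]|NJ1] := pselect (J 1).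
  have -> : f = f * (1 - a * e) + a * (e * f) by ring.
  by apply: (mD) => //; rewrite -[_ * _]addr0; exact: mD.
case: Nme; suff <- : J = mideal m by [].
apply: (mideal_max m).2 => //; split.
- by apply/mem_set/mJ.
- by apply/negP => /set_mem.
move=> a u v /set_mem[b mb] /set_mem[c mc]; apply/mem_set.
exists (a * b + c).
have -> : a * u + v - (a * b + c) * e = a * (u - b * e) + (v - c * e) by ring.
exact: mD.
Qed.

Definition zariski_open : set_system (mspec S) :=
  [set U | exists E : set S, U = ~` zeros E].

Lemma zariski_openT : zariski_open setT.
Proof.
exists [set 1]; apply/seteqP; split=> // m _ /(_ 1 erefl).
by have [] := mspec_ideal m.
Qed.

Lemma zariski_openI : setI_closed zariski_open.
Proof.
move=> _ _ [E ->] [F ->].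
exists [set x | exists e f, [/\ E e, F f & x = e * f]].
rewrite -setCU; congr (~` _); apply/seteqP; split=> m.
  have [m0 m1 mD] := mspec_ideal m.
  move=> [mE|mF] _ [e [f [Ee Ff ->]]].
    by rewrite mulrC -[_ * _]addr0; apply: (mD) => //; exact: mE.
  by rewrite -[_ * _]addr0; apply: (mD) => //; exact: mF.
move=> mEF; have [mE|/existsNP[e /not_implyP[Ee Nme]]] :=
  pselect (E `<=` mideal m); [by left|right=> f Ff].
by have [] : mideal m e \/ mideal m f by apply/mspec_prime/mEF; exists e, f.
Qed.

Lemma zariski_open_bigU (T : Type) (f : T -> set (mspec S)) :
  (forall i, zariski_open (f i)) -> zariski_open (\bigcup_i f i).
Proof.
move=> /choice[E fE]; exists (\bigcup_i E i).
rewrite -[LHS]setCK setC_bigcup; congr (~` _); apply/seteqP; split=> m.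
  move=> mf x [i _ Eix]; have := mf i I.
  by rewrite fE setCK; apply.
by move=> mE i _; rewrite fE setCK => x Eix; apply: mE; exists i.
Qed.

HB.instance Definition _ := isOpenTopological.Build (mspec S)
  zariski_openT zariski_openI zariski_open_bigU.

Lemma zariski_closedE (A : set (mspec S)) :
  closed A <-> exists E : set S, A = zeros E.
Proof.
rewrite -openC; split=> [[E AE]|[E ->]]; exists E => //.
by rewrite -[A]setCK AE setCK.
Qed.

End Zariski.

(* The data of a closed generic spin Legendrian of vanishing Maslov class from
   which its contact algebra is built: H_1, the finite set of Reeb chords with
   their gradings (for a fixed choice of capping paths), and, for each chord a,
   the finite set [disk a] of rigid holomorphic disks with positive puncture
   at a. A disk carries its orientation sign ((-1)^dsign), the homology class
   of its capped boundary, and the word of its negative punctures. *)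
Record chord_data := ChordData {
  H1 : zmodType;
  chord : finType;
  cdeg : chord -> int;
  disk : chord -> finType;
  dsign : forall a, disk a -> bool;
  dclass : forall a, disk a -> H1;
  dneg : forall a, disk a -> seq chord
}.

Definition boundary (k : comNzRingType) (L : chord_data) (a : chord L) :
    {malg (galg k (H1 L))[{fmonom (chord L)}]} :=
  \sum_(u : disk a)
    << (<< (-1) ^+ dsign u *g dclass u >> : galg k (H1 L)) *g FMonom (dneg u) >>.
Arguments boundary k {L} a.

(* [rigid_disk] is the dimension formula for rigid disks; no Maslov term
   occurs because the Maslov class vanishes. *)
Record legendrian (k : comNzRingType) := Legendrian {
  legendrian_data :> chord_data;
  H1_fingen : exists (m : nat) (s : m.-tuple (H1 legendrian_data)),
    forall v, inIntSpan s v;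
  rigid_disk : forall (a : chord legendrian_data) (u : disk a),
    wdeg (@cdeg legendrian_data) (dneg u) = cdeg a - 1;
  boundaryK : forall x,
    dext (@cdeg legendrian_data) (boundary k)
      (dext (@cdeg legendrian_data) (boundary k) x) = 0
}.

Section ContactAlgebra.
Context (k : comNzRingType) (L : legendrian k).

Lemma boundary_deg (a : chord L) (w : {fmonom (chord L)}) :
  w \in msupp (boundary k a) -> wdeg (@cdeg L) w = cdeg a - 1.
Proof.
rewrite -mcoeff_neq0 => bw; apply/eqP; apply: contraNT bw => Nw.
rewrite /boundary raddf_sum big1 // => u _; rewrite /= mcoeffU.
by case: eqVneq => // uw; case/eqP: Nw; rewrite -uw -(rigid_disk u).
Qed.

Definition contact_alg : dga (galg k (H1 L)) := Dga boundary_deg (@boundaryK k L).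

Definition contact_alg1 : dga k := chcoef (@gaug k (H1 L)) contact_alg.

Definition good_point (m : mspec (galg k (H1 L))) : Prop :=
  exists p : {lrmorphism galg k (H1 L) -> k | *%R},
    good_dga (chcoef p contact_alg) /\ mideal m = p @^-1` [set 0].

Definition Aug : set (mspec (galg k (H1 L))) := closure [set m | good_point m].

End ContactAlgebra.
Arguments Aug {k} L.

Definition divisible_by (R : comNzRingType) (X : finType) (h : X)
    (x : {malg R[{fmonom X}]}) : Prop :=
  forall w : {fmonom X}, w \in msupp x -> h \in (w : seq X).

(* The normal form of Ekholm-Etnyre-Sullivan for a cusp connected sum L1 # L2,
   expressed on contact-algebra data. [incl_bij] is the decomposition of H_1(L) for n >= 2, which identifies
   k[H_1(L)] with the tensor product of the k[H_1(Li)].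
   The chords of L = L1 # L2 are the [Some (inl c)] with c a chord of L1, the
   [Some (inr c)] with c a chord of L2, and the additional chord h = [None].
   The last three fields are the conditions over k; the three before them are
   the conditions over the group algebras. *)
Record cusp_sum (k : comNzRingType) (n : nat) (L1 L2 L : legendrian k) :=
  CuspSum {
  incl1 : {additive H1 L1 -> H1 L};
  incl2 : {additive H1 L2 -> H1 L};
  incl_bij : bijective (fun v : H1 L1 * H1 L2 => incl1 v.1 + incl2 v.2);
  sum_chord : option (chord L1 + chord L2) -> chord L;
  sum_chord_bij : bijective sum_chord;
  chord1 := fun c => sum_chord (Some (inl c));
  chord2 := fun c => sum_chord (Some (inr c));
  chordh := sum_chord None;
  cdeg1 : forall c, cdeg (chord1 c) = cdeg c;
  cdeg2 : forall c, cdeg (chord2 c) = cdeg c;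
  cdegh : cdeg chordh = n%:Z - 1;
  boundary1 : forall c : gen (contact_alg L1), divisible_by chordh
    (dgen (d := contact_alg L) (chord1 c)
     - mapalg (gmap incl1) chord1 (dgen c));
  boundary2 : forall c : gen (contact_alg L2), divisible_by chordh
    (dgen (d := contact_alg L) (chord2 c)
     - mapalg (gmap incl2) chord2 (dgen c));
  boundaryh : dgen (d := contact_alg L) chordh = 0;
  boundary11 : forall c : gen (contact_alg1 L1), divisible_by chordh
    (dgen (d := contact_alg1 L) (chord1 c) - mapalg id chord1 (dgen c));
  boundary12 : forall c : gen (contact_alg1 L2), divisible_by chordh
    (dgen (d := contact_alg1 L) (chord2 c) - mapalg id chord2 (dgen c));
  boundary1h : dgen (d := contact_alg1 L) chordh = 0
}.

Definition rho1 (k : comNzRingType) n (L1 L2 L : legendrian k)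
    (S : cusp_sum n L1 L2 L) : galg k (H1 L1) -> galg k (H1 L) :=
  gmap (incl1 S).
Definition rho2 (k : comNzRingType) n (L1 L2 L : legendrian k)
    (S : cusp_sum n L1 L2 L) : galg k (H1 L2) -> galg k (H1 L) :=
  gmap (incl2 S).

(* Main.v *)
(* Points of Spec k[H] are the characters k[H] -> k: since C is uncountable and
   k[H] has countable dimension, the inverses of the x - a (a in C) modulo a
   maximal ideal cannot be linearly independent, so some x - a lies in it.
   As H_1(L) = H_1(L1) + H_1(L2), a character p of k[H_1(L)] is a pair (p1, p2).

   An augmentation kills the chord h, because |h| = n - 1 > 0. Hence the words
   containing h do not matter, and the augmentations at p are the pairs of
   augmentations at p1 and p2: the good points of L are the pairs of good points.
   Finally the Zariski closure of a product is the product of the closures,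
   because a function on the product vanishing on the good points can be
   restricted to one factor at a time. *)

From HB Require Import structures.
Require Import Defs.
From mathcomp Require Import all_boot all_order all_algebra.
From mathcomp Require Import ring finmap monalg complex.
From mathcomp Require Import boolp classical_sets cardinality reals topology.
From mathcomp Require Import constructive_ereal lebesgue_measure.

Set Implicit Arguments.
Unset Strict Implicit.
Unset Printing Implicit Defensive.

Import Order.TTheory GRing.Theory Num.Theory.

Local Open Scope ring_scope.
Local Open Scope classical_set_scope.

(** * Augmentations as functions on generators *)

Section WordValue.
Context (X : choiceType) (S : comNzRingType) (e : X -> S).

(** The value on words of the unital algebra morphism given by [e] on letters; [mmap phi (wval e)]
    extends it along [phi]. *)
Definition wval (w : {fmonom X}) : S := \prod_(c <- w) e c.

Lemma wval_mmorphism : mmorphism wval.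
Proof.
by split=> [u v|]; rewrite /wval ?fmM ?big_cat // fm1 big_nil.
Qed.

HB.instance Definition _ := isMultiplicative.Build {fmonom X} S wval wval_mmorphism.

(** Each word of [x] contributes a factor [e h = 0]; this is how words through the additional chord
    disappear. *)
Lemma mmap_divisible0 (R : comNzRingType) (phi : {additive R -> S}) h
    (x : {malg R[{fmonom X}]}) :
  e h = 0 -> (forall w : {fmonom X}, w \in msupp x -> h \in (w : seq X)) ->
  mmap phi wval x = 0.
Proof.
move=> eh0 hx; rewrite mmapE big_seq big1 // => w /hx hw.
by rewrite /wval (big_rem h) //= eh0 mul0r mulr0.
Qed.

End WordValue.

Lemma mmap_mapalg (R S T : comNzRingType) (X Y : finType)
    (phi : {additive R -> S}) (psi : {additive S -> T}) (f : X -> Y)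
    (e : Y -> T) (x : {malg R[{fmonom X}]}) :
  mmap psi (wval e) (mapalg phi f x) = mmap (psi \o phi) (wval (e \o f)) x.
Proof.
rewrite [RHS]mmapE /mapalg raddf_sum; apply: eq_bigr => w _ /=.
by rewrite mmapU /wval /= big_map.
Qed.

(** A morphism out of a tensor algebra is determined by its values on letters. A word of nonzero
    degree has a letter of nonzero degree, and by the Leibniz rule it is enough to kill the
    differentials of the generators. *)
Lemma good_chcoefP (R S : comNzRingType) (phi : {rmorphism R -> S}) (D : dga R) :
  good_dga (chcoef phi D) <->
  exists e : gen D -> S, (forall c, deg c != 0 -> e c = 0) /\
    forall c : gen D, mmap phi (wval e) (dgen c) = 0.
Proof.
split=> [[eps [eps_deg epsd]]|[e [e_deg ed]]].
  pose e (c : gen D) := eps << FMonom [:: c] >>.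
  have epsU (w : {fmonom (gen D)}) : eps << w >> = wval e w.
    case: w => w; rewrite /wval /=; elim: w => [|c w IHw].
      by rewrite big_nil fmU1 rmorph1.
    by rewrite big_cons -IHw -rmorphM fmMU mulr1.
  have epsE x : eps x = mmap idfun (wval e) x.
    elim/malg_ind: x => [|x y Hx Hy|c w]; first by rewrite !raddf0.
      by rewrite !raddfD /= Hx Hy.
    rewrite mmapU -epsU -linearZ; congr (eps _).
    by apply/malgP => v; rewrite mcoeffZ !mcoeffU mulrnAr mulr1.
  exists e; split=> c.
    move=> deg_c; apply: eps_deg.
    by rewrite /wdeg big_seq1.
  have := epsd << FMonom [:: c] >>.
  by rewrite /diff dext_gen epsE /= mmap_mapalg.
exists (mmap idfun (wval e)); split=> [w|x].
  rewrite /= mmapU mul1r; case: w => w; rewrite /wdeg /wval /=.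
  elim: w => [|c w IHw]; first by rewrite big_nil eqxx.
  rewrite !big_cons; have [deg_c|/e_deg ->] := eqVneq (deg c) 0.
    by rewrite deg_c add0r => /IHw ->; rewrite mulr0.
  by rewrite mul0r.
elim/malg_ind: x => [|x y Hx Hy|a [w]].
- by rewrite /diff !raddf0.
- by rewrite /diff !raddfD /= Hx Hy addr0.
rewrite /diff dextU linearZ /=.
suff -> : mmap idfun (wval e) (dword (@deg _ (chcoef phi D)) (@dgen _ (chcoef phi D)) w) = 0.
  by rewrite mulr0.
elim: w => [|c w IHw]; first by rewrite raddf0.
rewrite /= mmapD mmapZ !rmorphM /= IHw !mulr0 addr0.
by rewrite mmap_mapalg ed mul0r.
Qed.

(** * Zariski closure and maximal ideals *)

Local Notation character k H := {lrmorphism galg k H -> k | *%R}.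

(** Closed sets are zero loci, so the closure can be tested one equation at a time. *)
Lemma zariski_closureP (S : comNzRingType) (A : set (mspec S)) m :
  closure A m <->
  forall f, (forall m', A m' -> mideal m' f) -> mideal m f.
Proof.
split=> [Am f fA|Am].
  suff : closure A `<=` zeros [set f] by move/(_ m Am f erefl).
  rewrite closureE; apply: smallest_sub.
    by apply/zariski_closedE; exists [set f].
  by move=> m' /fA m'f _ ->.
have /zariski_closedE[E AE] : closed (closure A) by exact: closed_closure.
rewrite AE => f Ef; apply: Am => m' /subset_closure.
by rewrite AE; exact.
Qed.

Section MaximalIdeal.
Context (A : comNzRingType) (m : mspec A).

Lemma mspecM a u : mideal m u -> mideal m (a * u).
Proof.
by have [m0 _ mD] := mspec_ideal m => mu; rewrite -[_ * _]addr0; exact: mD.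
Qed.

Lemma mspecD u v : mideal m u -> mideal m v -> mideal m (u + v).
Proof.
by have [_ _ mD] := mspec_ideal m => mu mv; rewrite -[u]mul1r; exact: mD.
Qed.

Lemma mspecN u : mideal m u -> mideal m (- u).
Proof. by rewrite -mulN1r; exact: mspecM. Qed.

Lemma mspec_sum I (r : seq I) (F : I -> A) :
  (forall i, mideal m (F i)) -> mideal m (\sum_(i <- r) F i).
Proof.
have [m0 _ _] := mspec_ideal m => mF.
by apply: big_ind => // u v; exact: mspecD.
Qed.

(** By maximality, [m] and [f] generate the unit ideal. *)
Lemma mspec_inv f : ~ mideal m f -> exists g, mideal m (1 - g * f).
Proof.
have [m0 m1 mD] := mspec_ideal m => Nmf.
pose J := [set x | exists a, mideal m (x - a * f)].
have mJ : mideal m `<=` J by move=> x mx; exists 0; rewrite mul0r subr0.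
have [//|NJ1] := pselect (J 1).
case: Nmf; suff <- : J = mideal m by exists 1; rewrite mul1r subrr.
apply: (mideal_max m).2 => //; split.
- exact/mem_set/mJ.
- by apply/negP => /set_mem.
move=> a u v /set_mem[b mb] /set_mem[c mc]; apply/mem_set.
exists (a * b + c).
have -> : a * u + v - (a * b + c) * f = a * (u - b * f) + (v - c * f) by ring.
exact: mD.
Qed.

End MaximalIdeal.

(** * Characters as points of the spectrum *)

Lemma galgUE (k : comNzRingType) (H : zmodType) (c : k) (a : H) :
  << c *g a >> = c *: (<< a >> : galg k H) :> galg k H.
Proof. by apply/malgP => b; rewrite mcoeffZ !mcoeffU mulrnAr mulr1. Qed.

Section Characters.
Context (k : fieldType) (H : zmodType).

Lemma character_ext (p q : character k H) :
  (forall a : H, p << a >> = q << a >>) -> p =1 q.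
Proof.
move=> pq; elim/malg_ind => [|x y Hx Hy|c a]; first by rewrite !raddf0.
  by rewrite !raddfD /= Hx Hy.
by rewrite galgUE !linearZ /= pq.
Qed.

Lemma character_lift (chi : H -> k) :
  chi 0 = 1 -> {morph chi : a b / a + b >-> a * b} ->
  exists p : character k H, forall a, p << a >> = chi a.
Proof.
move=> chi0 chiD.
(* [lext] takes values in a module, so [k] enters as [k^o]; the structures of a [character] are then
   rebuilt with target [k]. *)
pose f : galg k H -> k := lext (chi : H -> k^o).
have fD : zmod_morphism f by move=> x y; exact: (@lext_is_additive H k k^o chi x y).
have fM : monoid_morphism f by exact: (@lext_is_monoid_morphism k H k^o chi).
have fZ : scalable_for *%R f by move=> c x; exact: (@lext_is_scalable H k k^o chi c x).
pose p : character k H := HB.pack_for (character k H) f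
  (GRing.isZmodMorphism.Build (galg k H) k f fD)
  (GRing.isMonoidMorphism.Build (galg k H) k f fM)
  (GRing.isScalable.Build k (galg k H) k *%R f fZ).
by exists p => a; rewrite /= /f lextU scale1r.
Qed.

Lemma character_scalar (p : character k H) (c : k) : p c%:A = c.
Proof. by rewrite linearZ /= rmorph1 mulr1. Qed.

(** If [p x] is nonzero, the scalar [(p x)^-1] inverts [x] modulo the kernel, so no strictly larger
    ideal is proper. *)
Lemma ker_maximal (p : character k H) : maximal_ideal (p @^-1` [set 0]).
Proof.
have ker0 : p 0 = 0 by rewrite raddf0.
split=> [|J [J0 J1 JD] kerJ].
  split.
  - exact/mem_set.
  - by apply/negP => /set_mem /=; apply/eqP; rewrite rmorph1 oner_neq0.
  move=> a u v /set_mem /= pu /set_mem /= pv; apply/mem_set => /=.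
  by rewrite rmorphD rmorphM /= pu pv mulr0 addr0.
apply/seteqP; split=> // x Jx /=; apply/eqP/negPn/negP => px.
case/negP: J1; have -> : 1 = (p x)^-1%:A * x + (1 - (p x)^-1%:A * x) :> galg k H.
  by rewrite addrC subrK.
apply: (JD); first exact/mem_set.
apply/mem_set/kerJ => /=.
by rewrite rmorphB rmorph1 rmorphM /= character_scalar mulVf ?subrr.
Qed.

Definition ker_mspec (p : character k H) : mspec (galg k H) := MSpec (ker_maximal p).

(** The element [x - p x] lies in the common kernel, which forces [q x = p x]. *)
Lemma ker_mspec_ext (p q : character k H) : ker_mspec p = ker_mspec q -> p =1 q.
Proof.
move=> /(congr1 (@mideal _)) /= pq x; apply/esym/eqP; rewrite -subr_eq0; apply/eqP.
have : (p @^-1` [set 0]) (x - (p x)%:A) by rewrite /= rmorphB /= character_scalar subrr.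
by rewrite pq /= rmorphB /= character_scalar.
Qed.

Lemma eq_ker_mspec (p q : character k H) : p =1 q -> ker_mspec p = ker_mspec q.
Proof.
move=> pq; apply: mspec_inj => /=; apply/funext => x /=.
by rewrite pq.
Qed.

(** The hypothesis says that the residue field is [k]; the character is the residue map. *)
Lemma residue_character (m : mspec (galg k H)) :
  (forall x, exists c : k, mideal m (x - c%:A)) ->
  exists p : character k H, m = ker_mspec p.
Proof.
have [m0 m1 _] := mspec_ideal m => /choice[r mr].
(* Residues are unique: two of them differ by a scalar in [m], and a nonzero scalar is a unit. *)
have rU x c : mideal m (x - c%:A) -> r x = c.
  move=> mc; apply/eqP; rewrite -subr_eq0; apply/negPn/negP => rc.
  apply: m1; have -> : 1 = (r x - c)^-1%:A * ((x - c%:A) - (x - (r x)%:A)) :> galg k H.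
    have -> : (x - c%:A) - (x - (r x)%:A) = (r x - c)%:A by rewrite scalerBl; ring.
    by rewrite -scalerAl mul1r scalerA mulVf ?scale1r.
  by apply: mspecM; apply/mspecD/mspecN.
have [] := @character_lift (fun a => r << a >>).
- by apply: rU; rewrite scale1r subrr.
- move=> a b; apply: rU.
  have -> : << a + b >> = (<< a >> : galg k H) * (<< b >> : galg k H) :> galg k H.
    by rewrite galgMUU mulr1.
  set x : galg k H := << a >>; set y : galg k H := << b >>.
  have -> : x * y - (r x * r y)%:A = y * (x - (r x)%:A) + (r x)%:A * (y - (r y)%:A).
    have -> : (r x * r y)%:A = (r x)%:A * (r y)%:A :> galg k H.
      by rewrite -scalerAl mul1r scalerA.
    ring.
  by apply: mspecD; exact: mspecM.
(* By linearity [p x] is the residue of every [x], not only of group elements. *)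
move=> p pE; exists p; have pr x : mideal m (x - (p x)%:A).
  elim/malg_ind: x => [|x y Hx Hy|c a].
  - by rewrite rmorph0 scale0r subr0.
  - by rewrite rmorphD /= scalerDl opprD addrACA; exact: mspecD.
  have pE' : p (c *: (<< a >> : galg k H)) = c * r << a >>.
    by rewrite linearZ /=; congr (_ * _); exact: pE.
  rewrite galgUE pE' -scalerA -scalerBr.
  by rewrite -[_ - _]mul1r scalerAl; exact: mspecM.
apply: mspec_inj; apply/seteqP; split=> x /=.
  by move=> mx; rewrite -(rU _ _ (pr x)); apply: rU; rewrite scale0r subr0.
by move=> px; have := pr x; rewrite px scale0r subr0.
Qed.

End Characters.

(** * Weak Nullstellensatz over an uncountable field *)

Lemma lagrange_sum_neq0 (k : fieldType) n (a v : 'I_n -> k) (i : 'I_n) :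
  injective a -> v i != 0 ->
  \sum_(i < n) v i *: \prod_(j < n | j != i) ('X - (a j)%:P) != 0.
Proof.
(* At [a i] every summand but the [i]-th vanishes, and that one survives because the nodes are
   distinct. *)
move=> a_inj vi; apply/eqP => /(congr1 (horner^~ (a i))) /eqP.
have termE l : (v l *: \prod_(j < n | j != l) ('X - (a j)%:P)).[a i]
    = v l * \prod_(j < n | j != l) (a i - a j).
  by rewrite hornerZ horner_prod; under eq_bigr do rewrite hornerXsubC.
rewrite horner0 horner_sum (bigD1 i) //= termE.
rewrite [X in _ + X]big1 => [|l li]; last first.
  by rewrite termE (bigD1 i) 1?eq_sym //= subrr mul0r mulr0.
rewrite addr0 mulf_eq0 (negPf vi) => /prodf_eq0[j ji].
by rewrite subr_eq0 => /eqP /a_inj ij; rewrite ij eqxx in ji.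
Qed.

Section WeakNullstellensatz.
Context (k : closedFieldType) (A : comAlgType k) (m : mspec A) (x : A).
Hypothesis Nmx : forall c : k, ~ mideal m (x - c%:A).

(** Over an algebraically closed field [p] splits; as [m] is prime, it would contain a linear factor
    [x - z], against [Nmx]. *)
Lemma horner_alg_notin_mspec (p : {poly k}) : p != 0 -> ~ mideal m (horner_alg x p).
Proof.
have [_ m1 _] := mspec_ideal m => p0.
have [r ->] := closed_field_poly_normal p; rewrite linearZ /= => mr.
have {mr} : mideal m (horner_alg x (\prod_(z <- r) ('X - z%:P))).
  have /(mspecM ((lead_coef p)^-1)%:A) := mr.
  by rewrite -!scalerAl !mul1r scalerA mulVf ?scale1r ?lead_coef_eq0.
elim: r => [|z r IHr]; first by rewrite big_nil rmorph1.
rewrite big_cons rmorphM rmorphB /= horner_algX horner_algC.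
by case/mspec_prime => // /Nmx.
Qed.

(* Inverses of the x - a modulo m are linearly independent: clearing
   denominators in a relation gives a nonzero polynomial in x that lies in m. *)
Lemma inverses_free n (a : 'I_n -> k) (y : 'I_n -> A) (v : 'I_n -> k) :
  injective a -> (forall i, mideal m (1 - y i * (x - (a i)%:A))) ->
  \sum_(i < n) v i *: y i = 0 -> forall i, v i = 0.
Proof.
move=> a_inj my vy i; apply/eqP/negPn/negP => vi.
apply: (horner_alg_notin_mspec (lagrange_sum_neq0 a_inj vi)).
pose P i := \prod_(j < n | j != i) (x - (a j)%:A).
have PE : horner_alg x (\sum_(i < n) v i *: \prod_(j < n | j != i) ('X - (a j)%:P))
    = \sum_(i < n) v i *: P i.
  rewrite linear_sum; apply: eq_bigr => l _; rewrite linearZ /= -scalerAl mul1r.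
  congr (_ *: _); rewrite rmorph_prod; apply: eq_bigr => j _.
  by rewrite rmorphB /= horner_algX horner_algC.
rewrite PE; have -> : \sum_(i < n) v i *: P i = \sum_(i < n)
    (v i *: P i - \prod_(j < n) (x - (a j)%:A) * (v i *: y i)).
  by rewrite sumrB -mulr_sumr vy mulr0 subr0.
apply: mspec_sum => l.
rewrite (bigD1 l) //= -/(P l) -scalerAr -scalerBr.
have -> : P l - (x - (a l)%:A) * P l * y l = P l * (1 - y l * (x - (a l)%:A)) by ring.
by rewrite -[X in _ *: X]mul1r scalerAl; apply/mspecM/mspecM.
Qed.

End WeakNullstellensatz.

(** Otherwise every [x - c] is invertible modulo [m], and infinitely many of the inverses lie in the
    span of finitely many [e j], against [inverses_free]. *)
Lemma weak_nullstellensatz (k : closedFieldType) (A : comAlgType k)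
    (e : nat -> A) (m : mspec A) (x : A) :
  ~ countable [set: k] -> (forall y, exists z : {malg k[nat]}, y = lext e z) ->
  exists c : k, mideal m (x - c%:A).
Proof.
move=> kunc espan; apply: contrapT => /forallNP Nmx.
have /choice[z mz] : forall c, exists z : {malg k[nat]},
    mideal m (1 - lext e z * (x - c%:A)).
  move=> c; have [g mg] := mspec_inv (Nmx c).
  by have [z zE] := espan g; exists z; rewrite -zE.
(* [N c] bounds the indices in the expansion of the inverse of [x - c]. *)
have /choice[N zN] : forall c, exists n, forall j, (n <= j)%N -> (z c)@_j = 0.
  move=> c; exists (\max_(j <- msupp (z c)) j).+1 => j; rewrite ltnNge.
  apply: contraNeq; rewrite mcoeff_neq0 => jz.
  by rewrite (big_fsetD1 j) //= leq_maxl.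
(* Countably many finite fibres of [N] cannot cover the uncountable [k]. *)
have [n Nn] : exists n, infinite_set [set c | N c = n].
  apply: contrapT => /forallNP Nfin; apply: kunc.
  have -> : [set: k] = \bigcup_n [set c | N c = n].
    by apply/seteqP; split=> // c _; exists (N c).
  apply: bigcup_countable => // n _; apply: finite_set_countable.
  exact: contrapT (Nfin n).
have [B BN Bn] := infinite_set_fset n.+1 Nn.
pose a (i : 'I_(size B)) := (enum_fset B)`_i.
have a_inj : injective a.
  by move=> i j /eqP; rewrite nth_uniq ?fset_uniq // => /eqP /val_inj.
have aN i j : (n <= j)%N -> (z (a i))@_j = 0.
  have /BN /= <- : [set` B] (a i) by rewrite /= mem_nth.
  exact: zN.
(* There are more than [n] rows and only [n] columns, so some nonzero [v] gives a relation between
   the rows. *)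
pose M := \matrix_(i < size B, j < n) (z (a i))@_(j : nat).
have /rowV0Pn[v /sub_kermxP vM] : kermx M != 0.
  rewrite kermx_eq0 /row_free neq_ltn; apply/orP; left.
  exact: leq_ltn_trans (rank_leq_col M) Bn.
case/rV0Pn => i; apply/negP/negPn/eqP.
apply: (inverses_free Nmx a_inj (fun i => mz (a i))).
transitivity (lext e (\sum_i v 0 i *: z (a i))).
  by rewrite raddf_sum; apply: eq_bigr => l _; rewrite /= linearZ.
rewrite -[RHS](raddf0 (lext e)); congr (lext e _).
apply/malgP => j; rewrite mcoeff0 raddf_sum /=.
have [jn|nj] := ltnP j n; last first.
  by rewrite big1 // => l _; rewrite mcoeffZ aN ?mulr0.
have /rowP/(_ (Ordinal jn)) := vM; rewrite !mxE => vMj.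
by rewrite -[RHS]vMj; apply: eq_bigr => l _; rewrite mxE mcoeffZ.
Qed.

(** Integer coefficient vectors are countable and reach all of [H]; numbers that encode no vector
    are sent to 0. *)
Lemma galg_spanned (k : comNzRingType) (H : zmodType) :
  (exists (n : nat) (s : n.-tuple H), forall v, inIntSpan s v) ->
  exists e : nat -> galg k H, forall y, exists z : {malg k[nat]}, y = lext e z.
Proof.
move=> [n [s sP]].
pose e i : galg k H := if choice.unpickle i is Some z
  then << \sum_(j < n) s`_j *~ (z : int ^ n) j >> else 0.
exists e; elim/malg_ind => [|x y [z ->] [t ->]|c a].
- by exists 0; rewrite raddf0.
- by exists (z + t); rewrite raddfD.
have [z aE] := sP a; exists << c *g choice.pickle (z : int ^ n) >>.
by rewrite lextU /e choice.pickleK -aE galgUE.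
Qed.

(** A countable set has Lebesgue measure 0, while the real unit interval has measure 1. *)
Lemma complex_uncountable (R : realType) : ~ countable [set: R[i]].
Proof.
move=> /countable_injP[f f_inj].
have : countable `[0, 1 : R].
  apply/countable_injP; exists (fun x => f x%:C%C) => x y _ _ fxy.
  have := f_inj x%:C%C y%:C%C; rewrite !in_setT => /(_ isT isT fxy).
  by case.
move=> /countable_lebesgue_measure0; rewrite lebesgue_measure_itv /=.
by rewrite lte_fin ltr01 oppr0 adde0 => /eqP; rewrite eqe oner_eq0.
Qed.

Lemma mspec_character (R : realType) (H : zmodType) (m : mspec (galg R[i] H)) :
  (exists (n : nat) (s : n.-tuple H), forall v, inIntSpan s v) ->
  exists p : character R[i] H, m = ker_mspec p.
Proof.
move=> /(galg_spanned R[i])[e espan]; apply: residue_character => x.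
exact: (@weak_nullstellensatz R[i] (galg R[i] H) e m x (@complex_uncountable R) espan).
Qed.

(** * Characters of a direct sum *)

Section DirectSum.
Context (k : fieldType) (H H1 H2 : zmodType).
Context (i1 : {additive H1 -> H}) (i2 : {additive H2 -> H}).
Hypothesis i_bij : bijective (fun v : H1 * H2 => i1 v.1 + i2 v.2).

Definition pullback (H0 : zmodType) (i : {additive H0 -> H}) (p : character k H) :
  character k H0 := p \o gmap i.

Lemma pullbackU (H0 : zmodType) (i : {additive H0 -> H}) p a :
  pullback i p << a >> = p << i a >>.
Proof. by rewrite /= /gmap lextU scale1r. Qed.

Lemma character_sumE (p : character k H) a b :
  p << i1 a + i2 b >> = pullback i1 p << a >> * pullback i2 p << b >>.
Proof.
rewrite !pullbackU -rmorphM; congr (p _).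
by rewrite galgMUU mulr1.
Qed.

Lemma character_sum_ext (p q : character k H) :
  pullback i1 p =1 pullback i1 q -> pullback i2 p =1 pullback i2 q -> p =1 q.
Proof.
move=> pq1 pq2; apply: character_ext => h.
have [g _ gK] := i_bij; rewrite -[h]gK.
by rewrite !character_sumE pq1 pq2.
Qed.

Lemma characterD (H0 : zmodType) (p : character k H0) a b :
  p << a + b >> = p << a >> * p << b >>.
Proof. by rewrite -rmorphM; congr (p _); rewrite galgMUU mulr1. Qed.

Lemma character_sum_lift (p1 : character k H1) (p2 : character k H2) :
  exists p : character k H, pullback i1 p =1 p1 /\ pullback i2 p =1 p2.
Proof.
have [g gK Kg] := i_bij.
have gE a b : g (i1 a + i2 b) = (a, b) by exact: (gK (a, b)).
have gD h h' : g (h + h') = ((g h).1 + (g h').1, (g h).2 + (g h').2).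
  by rewrite -gE !raddfD /= addrACA !Kg.
have g0 : g 0 = (0, 0) by rewrite -gE !raddf0 addr0.
have p0 (H0 : zmodType) (p : character k H0) : p << 0 >> = 1.
  exact: (rmorph1 p).
(* The product of the two characters, read through the inverse [g] of the decomposition. *)
have [||p pE] := @character_lift k H (fun h => p1 << (g h).1 >> * p2 << (g h).2 >>).
- by rewrite g0 !p0 mulr1.
- by move=> h h'; rewrite gD !characterD mulrACA.
exists p; split; apply: character_ext => a; rewrite pullbackU pE.
  by rewrite -[i1 a]addr0 -(raddf0 i2) gE p0 mulr1.
by rewrite -[i2 a]add0r -(raddf0 i1) gE p0 mul1r.
Qed.

(* Evaluating one of the two factors of k[H] = k[H1] (x) k[H2] at a point
   turns f into a function on the other factor. *)
Lemma slice1 (p2 : character k H2) (f : galg k H) :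
  exists f1 : galg k H1, forall p : character k H,
    pullback i2 p =1 p2 -> p f = pullback i1 p f1.
Proof.
elim/malg_ind: f => [|x y [x1 xE] [y1 yE]|c h].
- by exists 0 => p _; rewrite !rmorph0.
- exists (x1 + y1) => p pp2; rewrite [LHS]rmorphD [RHS]rmorphD.
  by congr (_ + _); [exact: xE|exact: yE].
have [g _ gK] := i_bij.
exists ((c * p2 << (g h).2 >>) *: << (g h).1 >>) => p pp2.
rewrite galgUE [LHS]linearZ [RHS]linearZ /= -mulrA; congr (_ * _).
rewrite -[in LHS](gK h) (character_sumE p) pp2.
exact: mulrC.
Qed.

End DirectSum.

(** This is [slice1] with the two summands exchanged. *)
Lemma slice2 (k : fieldType) (H H1 H2 : zmodType)
    (i1 : {additive H1 -> H}) (i2 : {additive H2 -> H})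
    (p1 : character k H1) (f : galg k H) :
  bijective (fun v : H1 * H2 => i1 v.1 + i2 v.2) ->
  exists f2 : galg k H2, forall p : character k H,
    pullback i1 p =1 p1 -> p f = pullback i2 p f2.
Proof.
move=> [g gK Kg]; apply: slice1.
exists (fun h => ((g h).2, (g h).1)) => [[a b]|h] /=.
  by rewrite addrC (gK (b, a)).
by rewrite addrC Kg.
Qed.

(** * Zariski closure of a product *)

Section Closures.
Context (k : fieldType).

Lemma closure_kerP (H : zmodType) (Q : character k H -> Prop) p :
  closure [set m | exists q, Q q /\ m = ker_mspec q] (ker_mspec p) <->
  forall f, (forall q, Q q -> q f = 0) -> p f = 0.
Proof.
split=> [/zariski_closureP clQ f Qf|clQ].
  by apply: clQ => m' [q [Qq ->]]; exact: Qf.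
apply/zariski_closureP => f Qf; apply: clQ => q Qq.
by apply: (Qf (ker_mspec q)); exists q.
Qed.

(** Stability of [Q1] and [Q2] under [=1] is assumed because [character_sum_lift] prescribes
    pullbacks only pointwise. *)
Lemma closure_prodP (H H1 H2 : zmodType)
    (i1 : {additive H1 -> H}) (i2 : {additive H2 -> H})
    (Q : character k H -> Prop)
    (Q1 : character k H1 -> Prop)
    (Q2 : character k H2 -> Prop) p :
  bijective (fun v : H1 * H2 => i1 v.1 + i2 v.2) ->
  (forall q q' : character k H1, q =1 q' -> Q1 q -> Q1 q') ->
  (forall q q' : character k H2, q =1 q' -> Q2 q -> Q2 q') ->
  (forall q, Q q <-> Q1 (pullback i1 q) /\ Q2 (pullback i2 q)) ->
  closure [set m | exists q, Q q /\ m = ker_mspec q] (ker_mspec p) <->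
  closure [set m | exists q, Q1 q /\ m = ker_mspec q] (ker_mspec (pullback i1 p)) /\
  closure [set m | exists q, Q2 q /\ m = ker_mspec q] (ker_mspec (pullback i2 p)).
Proof.
move=> i_bij Q1_ext Q2_ext QE; rewrite !closure_kerP; split=> [clQ|[clQ1 clQ2] f Qf].
  (* An equation on one factor becomes, through [gmap], an equation on the product. *)
  split=> f Qf; [apply: (clQ (gmap i1 f))|apply: (clQ (gmap i2 f))] => q /QE[Q1q Q2q].
    exact: (Qf (pullback i1 q)).
  exact: (Qf (pullback i2 q)).
(* With the first factor fixed in [Q1], the second moves from [Q2] to its closure point
   [pullback i2 p]. *)
have Qf2 (q1 : character k H1) q : Q1 q1 ->
    pullback i1 q =1 q1 -> pullback i2 q =1 pullback i2 p -> q f = 0.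
  move=> Q1q1 qq1 qp2; have [f2 f2E] := slice2 q1 f i_bij.
  rewrite f2E // qp2; apply: clQ2 => q2 Q2q2.
  have [r [rq1 rq2]] := character_sum_lift i_bij q1 q2.
  rewrite -rq2 -f2E //; apply/Qf/QE; split.
    by apply: Q1_ext Q1q1 => x; rewrite rq1.
  by apply: Q2_ext Q2q2 => x; rewrite rq2.
(* Now the second factor stays at [pullback i2 p], and the first moves to the closure of [Q1]. *)
have [f1 f1E] := slice1 i_bij (pullback i2 p) f.
rewrite f1E //; apply: clQ1 => q1 Q1q1.
have [r [rq1 rp2]] := character_sum_lift i_bij q1 (pullback i2 p).
by rewrite -rq1 -f1E //; exact: (Qf2 q1).
Qed.

End Closures.

(** * Good points of the connected sum *)

Lemma good_chcoef_ext (R S : comNzRingType) (phi psi : {rmorphism R -> S}) (D : dga R) :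
  phi =1 psi -> good_dga (chcoef phi D) -> good_dga (chcoef psi D).
Proof.
move=> phipsi /good_chcoefP[e [e_deg ed]]; apply/good_chcoefP; exists e; split=> // c.
rewrite -[RHS](ed c) !mmapE; apply: eq_bigr => w _.
by rewrite phipsi.
Qed.

Lemma good_cusp_sum (k : fieldType) (n : nat) (L1 L2 L : legendrian k)
    (S : cusp_sum n L1 L2 L) (p : character k (H1 L)) :
  (2 <= n)%N ->
  good_dga (chcoef p (contact_alg L)) <->
  good_dga (chcoef (pullback (incl1 S) p) (contact_alg L1)) /\
  good_dga (chcoef (pullback (incl2 S) p) (contact_alg L2)).
Proof.
move=> n2.
(* Once [h] is sent to 0, the boundary in [L] of a chord of [L1] has the value of its boundary in
   [L1]: coefficients pushed along [gmap] and evaluated at [p] are evaluated at the pullback. *)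
have bd1 (e : chord L -> k) (c : chord L1) : e (chordh S) = 0 ->
    mmap p (wval e) (boundary k (chord1 S c)) =
    mmap (pullback (incl1 S) p) (wval (e \o chord1 S)) (boundary k c).
  move=> eh0; rewrite -[RHS](mmap_mapalg (gmap (incl1 S)) p); apply/eqP.
  rewrite -subr_eq0 -raddfB; apply/eqP.
  exact: (mmap_divisible0 p eh0 (@boundary1 _ _ _ _ _ S c)).
have bd2 (e : chord L -> k) (c : chord L2) : e (chordh S) = 0 ->
    mmap p (wval e) (boundary k (chord2 S c)) =
    mmap (pullback (incl2 S) p) (wval (e \o chord2 S)) (boundary k c).
  move=> eh0; rewrite -[RHS](mmap_mapalg (gmap (incl2 S)) p); apply/eqP.
  rewrite -subr_eq0 -raddfB; apply/eqP.
  exact: (mmap_divisible0 p eh0 (@boundary2 _ _ _ _ _ S c)).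
rewrite !good_chcoefP /=; split=> [[e [e_deg ed]]|[[e1 [e1_deg e1d]] [e2 [e2_deg e2d]]]].
  (* [h] has degree [n - 1], which is nonzero as [n] is at least 2. *)
  have eh0 : e (chordh S) = 0.
    apply: e_deg; rewrite cdegh subr_eq0; apply/eqP => n1.
    by move: n2; case: n1 => ->.
  split.
    exists (e \o chord1 S); split=> c; last by rewrite -bd1.
    by rewrite -(cdeg1 S) => /e_deg.
  exists (e \o chord2 S); split=> c; last by rewrite -bd2.
  by rewrite -(cdeg2 S) => /e_deg.
have [s sK Ks] := sum_chord_bij S.
(* The two augmentations glue, with the forced value 0 on [h]. *)
pose e c := match s c with
  Some (inl c1) => e1 c1 | Some (inr c2) => e2 c2 | None => 0 end.
have eh0 : e (chordh S) = 0 by rewrite /e sK.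
have ee1 : e \o chord1 S =1 e1 by move=> c; rewrite /e /= sK.
have ee2 : e \o chord2 S =1 e2 by move=> c; rewrite /e /= sK.
exists e; split=> c; rewrite -[c]Ks; case: (s c) => [[c1|c2]|].
- by rewrite -/(chord1 S c1) cdeg1 => /e1_deg <-; exact: ee1.
- by rewrite -/(chord2 S c2) cdeg2 => /e2_deg <-; exact: ee2.
- by [].
- by rewrite -/(chord1 S c1) bd1 // (funext ee1).
- by rewrite -/(chord2 S c2) bd2 // (funext ee2).
have bh : boundary k (chordh S) = 0 := boundaryh S.
by rewrite -/(chordh S) bh raddf0.
Qed.

(** * The product formula for augmentation varieties *)

Lemma AugE (k : fieldType) (L : legendrian k) :
  Aug L = closure [set m | exists q : character k (H1 L),
    good_dga (chcoef q (contact_alg L)) /\ m = ker_mspec q].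
Proof.
congr closure; apply/seteqP; split=> m [q [q_good mq]]; exists q; split=> //.
  exact: mspec_inj.
by rewrite mq.
Qed.

Theorem theorem4p7 (R : realType) (n : nat) (hn : (2 <= n)%N)
    (L1 L2 L : legendrian R[i]) (S : cusp_sum n L1 L2 L) :
  exists Phi : mspec (galg R[i] (H1 L)) ->
               mspec (galg R[i] (H1 L1)) * mspec (galg R[i] (H1 L2)),
    [/\ bijective Phi,
        (forall m, mideal (Phi m).1 = rho1 S @^-1` mideal m /\
                   mideal (Phi m).2 = rho2 S @^-1` mideal m)
      & Aug L1 `*` Aug L2 = Phi @` Aug L].
Proof.
have /choice[chi chiE] : forall m : mspec (galg R[i] (H1 L)),
    exists p : character R[i] (H1 L), m = ker_mspec p.
  by move=> m; exact: mspec_character (H1_fingen L).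
(* A point of the spectrum is sent to the restrictions of its character to the two factors. *)
pose Phi m := (ker_mspec (pullback (incl1 S) (chi m)),
               ker_mspec (pullback (incl2 S) (chi m))).
have Phi_onto y : exists m, Phi m = y.
  case: y => m1 m2.
  have [p1 ->] := mspec_character m1 (H1_fingen L1).
  have [p2 ->] := mspec_character m2 (H1_fingen L2).
  have [p [pp1 pp2]] := character_sum_lift (incl_bij S) p1 p2.
  (* The chosen character [chi] is tied to [p] only through its kernel, which determines it
     pointwise. *)
  have chip : chi (ker_mspec p) =1 p.
    by apply: ker_mspec_ext; rewrite -chiE.
  exists (ker_mspec p); congr (_, _); apply: eq_ker_mspec => x.
    by rewrite -pp1; exact: chip.
  by rewrite -pp2; exact: chip.
have Phi_inj : injective Phi.
  move=> m m' eqPhi; rewrite (chiE m) (chiE m'); apply: eq_ker_mspec.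
  apply: (character_sum_ext (incl_bij S)); apply: ker_mspec_ext.
    exact: (congr1 fst eqPhi).
  exact: (congr1 snd eqPhi).
have PhiAug m : Aug L m <-> (Aug L1 `*` Aug L2) (Phi m).
  rewrite !AugE [in X in X <-> _](chiE m).
  apply: closure_prodP (incl_bij S) _ _ (fun q => good_cusp_sum S q hn);
  by move=> q q' qq'; apply: good_chcoef_ext => x; exact: qq'.
exists Phi; split.
- have /choice[Psi PsiK] := Phi_onto.
  by exists Psi => // m; apply: Phi_inj; rewrite PsiK.
(* The kernel of a pullback is by definition the preimage of the kernel of [chi m], which is [m]. *)
- by move=> m; have /(congr1 (@mideal _)) -> := chiE m.
apply/seteqP; split=> [y|_ [m /PhiAug ? <-]//].
by have [m <-] := Phi_onto y => /PhiAug mA; exists m.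
Qed.
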